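(* Let $H$ be a finite dimensional real or complex Hilbert space. Let $N$ be a positive integer, and let $T_1, \ldots, T_k$ be a $k$-tuple of commuting contractions on $H$ that has a unitary $N$-dilation acting on a finite dimensional Hilbert space $K$. Put $m = \dim K$. Then there exist $m$ points $w^i = (w^i_1, \ldots, w^i_k)$, $i = 1, \ldots, m$, on the $k$-torus $\mathbb{T}^k$ such that for every polynomial $p(z_1, \ldots, z_k)$ (with coefficients in the scalar field of $H$) of degree less than or equal to $N$, $$\|p(T_1, \ldots, T_k)\| \leq \max\{|p(w^i)| : i = 1, \ldots, m\}.$$ In particular, for every such polynomial, $$\|p(T_1, \ldots, T_k)\| \leq \|p\|_\infty := \sup\{|p(z_1, \ldots, z_k)| : |z_i| = 1,\ i = 1, \ldots, k\}.$$
   Context: A contraction is a linear operator $T$ with $\|T\| \le 1$. $\mathbb{T} = \{z \in \mathbb{C} : |z| = 1\}$. Degree means total degree. A unitary $N$-dilation for commuting contractions $T_1, \ldots, T_k$ on $H$ is a $k$-tuple of commuting unitaries $U_1, \ldots, U_k$ acting on a Hilbert space $K \supseteq H$ (over the same scalar field) such that $T_1^{n_1} \cdots T_k^{n_k} = P_H U_1^{n_1} \cdots U_k^{n_k} P_H$ (as operators on $H$) for all non-negative integers $n_1, \ldots, n_k$ satisfying $n_1 + \cdots + n_k \leq N$, where $P_H$ is the orthogonal projection of $K$ onto $H$. *)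

(* Defs.v *)
From mathcomp Require Import all_boot all_order all_algebra.
From mathcomp Require Import complex mpoly.
From mathcomp Require Import classical_sets reals.

Set Implicit Arguments.
Unset Strict Implicit.
Unset Printing Implicit Defensive.

Import Order.TTheory GRing.Theory Num.Theory.
Local Open Scope ring_scope.

Variant scalar_kind := RealScalars | ComplexScalars.

Definition scalars (R : realType) (s : scalar_kind) : numFieldType :=
  match s with RealScalars => R | ComplexScalars => R[i]%C end.

Definition scalar_conj (R : realType) (s : scalar_kind) :
    {rmorphism scalars R s -> scalars R s} :=
  match s return {rmorphism scalars R s -> scalars R s} with
  | RealScalars => idfun : {rmorphism R -> R}
  | ComplexScalars => @conjc R : {rmorphism R[i]%C -> R[i]%C}
  end.

Definition to_complex (R : realType) (s : scalar_kind) :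
    {rmorphism scalars R s -> R[i]%C} :=
  match s return {rmorphism scalars R s -> R[i]%C} with
  | RealScalars => real_complex R : {rmorphism R -> R[i]%C}
  | ComplexScalars => idfun : {rmorphism R[i]%C -> R[i]%C}
  end.

Definition torus (R : realType) (k : nat) : set ('I_k -> R[i]%C) :=
  [set z | forall i, ComplexField.Normc.normc (z i) = 1]%classic.

Arguments torus : clear implicits.

(* A finite-dimensional Hilbert space over [scalars R s] is a vectType with a
   positive definite Hermitian form; completeness is automatic. *)
Notation hilbert_dot R s H := {dot H for scalar_conj R s}.

Section Operators.
Variables (R : realType) (s : scalar_kind).

Definition hnorm (H : vectType (scalars R s)) (dot : hilbert_dot R s H) (x : H)
    : R :=
  Num.sqrt (complex.Re (to_complex R s (dot x x))).

Definition opnorm (H : vectType (scalars R s)) (dot : hilbert_dot R s H)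
    (T : 'End(H)) : R :=
  sup [set hnorm dot (T x) | x in [set x | hnorm dot x <= 1]]%classic.

Definition contraction (H : vectType (scalars R s)) (dot : hilbert_dot R s H)
    (T : 'End(H)) : Prop :=
  opnorm dot T <= 1.

Definition commuting (H : vectType (scalars R s)) (k : nat)
    (T : 'I_k -> 'End(H)) : Prop :=
  forall i j, (T i \o T j = T j \o T i)%VF.

Definition unitary_op (K : vectType (scalars R s)) (dot : hilbert_dot R s K)
    (U : 'End(K)) : Prop :=
  isometry dot dot U /\ limg U = fullv.

Definition orthoproj (K : vectType (scalars R s)) (dot : hilbert_dot R s K)
    (V : {vspace K}) : 'End(K) :=
  daddv_pi V (orthov dot V).

(* 'End(H) is canonically a ring only for falgTypes, so products and powers
   of operators are written with composition. *)
Definition monomial_op (H : vectType (scalars R s)) (k : nat)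
    (T : 'I_k -> 'End(H)) (n : 'I_k -> nat) : 'End(H) :=
  \big[@comp_lfun _ H H H / \1%VF]_(i < k) iter (n i) (comp_lfun (T i)) \1%VF.

Definition poly_op (H : vectType (scalars R s)) (k : nat)
    (T : 'I_k -> 'End(H)) (p : {mpoly (scalars R s)[k]}) : 'End(H) :=
  \sum_(n <- msupp p) p@_n *: monomial_op T n.

(* The inclusion of H in K is a linear isometry [emb], so that H is identified
   with [limg emb]. *)
Definition unitary_dilation (H : vectType (scalars R s))
    (dotH : hilbert_dot R s H) (K : vectType (scalars R s))
    (dotK : hilbert_dot R s K) (emb : 'Hom(H, K)) (N k : nat)
    (T : 'I_k -> 'End(H)) (U : 'I_k -> 'End(K)) : Prop :=
  let P := orthoproj dotK (limg emb) in
  [/\ isometry dotK dotH emb,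
      forall i, unitary_op dotK (U i),
      commuting U &
      forall n : 'I_k -> nat, (\sum_(i < k) n i <= N)%N ->
        forall h : H,
          emb (monomial_op T n h) = P (monomial_op U n (P (emb h)))].

Definition poly_at (k : nat) (p : {mpoly (scalars R s)[k]})
    (z : 'I_k -> R[i]%C) : R[i]%C :=
  mmap (to_complex R s) z p.

Definition torus_sup_norm (k : nat) (p : {mpoly (scalars R s)[k]}) : R :=
  sup [set ComplexField.Normc.normc (poly_at p z) | z in torus R k]%classic.

End Operators.

(* Main.v *)
(* The matrices of the [U i] in an orthonormal basis of [K], read over [R[i]]
   when the scalars are real, are commuting unitaries, so one unitary change of
   basis diagonalizes them all; the [j]-th diagonal entries form the point
   [w j] of the torus.  In these coordinates [poly_op U p] multiplies the
   [j]-th coordinate by [p (w j)], so its norm is at most the maximum of the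
   moduli [|p (w j)|].  For [p] of degree at most [N], [poly_op T p] is the
   compression of [poly_op U p] to [H], so its norm is no larger. *)
Require Import Defs.
From mathcomp Require Import all_boot all_order all_algebra.
From mathcomp Require Import complex mpoly.
From mathcomp Require Import classical_sets reals.

Set Implicit Arguments.
Unset Strict Implicit.
Unset Printing Implicit Defensive.

Import Order.TTheory GRing.Theory Num.Theory.
Local Open Scope ring_scope.

(** * Simultaneous diagonalization of commuting unitary matrices *)

Section Codiagonalization.
Local Open Scope sesquilinear_scope.
Variable C : numClosedFieldType.

Lemma comm_mx_invr n (A B : 'M[C]_n) :
  B \in unitmx -> comm_mx A B -> comm_mx A (invmx B).
Proof.
move=> Bunit AB; rewrite /comm_mx; apply: (can_inj (mulmxK Bunit)).
by rewrite mulmxKV // -mulmxA AB mulKmx.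
Qed.

Lemma unitarymx_codiagonalization n k (B : 'I_k -> 'M[C]_n) :
    (forall i, B i \is unitarymx) -> (forall i j, comm_mx (B i) (B j)) ->
  exists2 P : 'M[C]_n, P \is unitarymx &
    exists2 d : 'I_k -> 'rV[C]_n, (forall i j, `|d i 0 j| = 1) &
      forall i, B i *m P^t* = P^t* *m diag_mx (d i).
Proof.
move=> Bu Bc.
have Bunit i : B i \in unitmx by apply: unitarymx_unit.
have BVc i j : comm_mx (B i) (invmx (B j)) by apply: comm_mx_invr.
(* The inverses are the adjoints: triangularizing them as well makes each [B i]
   both lower and upper triangular. *)
pose As := codom B ++ codom (fun i => invmx (B i)).
have [|P Pu /allP PA] := @cotrigonalization _ _ As.
  move=> X Y; rewrite !mem_cat => /orP[] /codomP[i ->] /orP[] /codomP[j ->].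
  - exact: Bc.
  - exact: BVc.
  - exact/esym/BVc.
  - by apply: comm_mx_invr => //; exact/esym/BVc.
pose D i := P *m B i *m P^t*.
have Du i : D i \is unitarymx by rewrite !mul_unitarymx ?trmxC_unitary.
have DtE i : (D i)^t* = P *m invmx (B i) *m P^t*.
  by rewrite /D !trmx_mul !map_mxM trmxCK invmx_unitary // mulmxA.
have D_diag i a b : a != b -> D i a b = 0.
  rewrite -val_eqE /=; case: ltngtP => // lt_ab _.
    have := PA (B i); rewrite mem_cat codom_f => /(_ isT).
    by rewrite inE /similar_to conjymx // => /is_trig_mxP; apply.
  have := PA (invmx (B i)); rewrite mem_cat orbC.
  rewrite (codom_f (fun i => invmx (B i))) => /(_ isT).
  rewrite inE /similar_to conjymx // => /is_trig_mxP/(_ b a lt_ab).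
  rewrite -DtE 2!mxE => /eqP.
  by rewrite conjC_eq0 => /eqP.
exists P => //; exists (fun i => \row_j D i j j) => [i j|i].
  (* As [D i] is diagonal, the [(j, j)] entry of [D i *m (D i)^t* = 1] reduces to the single term
     [|D i j j| ^+ 2]. *)
  have /unitarymxP/matrixP/(_ j j) := Du i.
  rewrite !mxE (bigD1 j) //= big1 ?addr0 => [|l lj]; last first.
    by rewrite D_diag ?mul0r // eq_sym.
  rewrite !mxE eqxx -normCK => /eqP.
  by rewrite pexpr_eq1 // => /eqP.
have -> : diag_mx (\row_j D i j j) = D i.
  apply/matrixP=> a b; rewrite [LHS]mxE [X in X *+ _]mxE; case: eqVneq => [->//|ab].
  by rewrite mulr0n D_diag.
by rewrite /D !mulmxA -invmx_unitary // mulVmx ?mul1mx ?unitarymx_unit.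
Qed.

End Codiagonalization.

(** * Real and complex scalars treated uniformly *)

Section Scalars.
Variables (R : realType) (s : scalar_kind).
Local Notation F := (scalars R s).
Local Notation tc := (to_complex R s).
Local Notation normc := ComplexField.Normc.normc.

Lemma to_complex_conj (a : F) : tc (scalar_conj R s a) = (tc a)^*.
Proof.
case: s a => a /=; last by [].
by rewrite [RHS]conjc_real.
Qed.

(** A square root of [a] works over both fields, being real and nonnegative. This supplies the
    normalizing factors of Gram-Schmidt. *)
Lemma ex_norm_sqr (a : F) : 0 <= a -> exists c, c * scalar_conj R s c = a.
Proof.
case: s a => a a0 /=.
  by exists (Num.sqrt a); rewrite -expr2 sqr_sqrtr.
exists (sqrtC a).
rewrite -[RHS]sqrtCK -[sqrtC a in RHS]ger0_norm ?sqrtC_ge0 //.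
by rewrite normCK.
Qed.

Lemma to_complex_ge0 (a : F) : 0 <= a -> 0 <= tc a.
Proof. by case: s a => a //=; rewrite ler0c. Qed.

Lemma normc_ge0 (z : R[i]) : 0 <= normc z.
Proof. by case: z => a b; apply: sqrtr_ge0. Qed.

Lemma norm_complexE (z : R[i]) : `|z| = (normc z)%:C%C.
Proof. by []. Qed.

End Scalars.

(** * Orthonormal bases and orthogonal projections *)

Section Hilbert.
Variables (R : realType) (s : scalar_kind).
Local Notation F := (scalars R s).
Variables (H : vectType F) (dot : hilbert_dot R s H).

Lemma dotC x y : dot x y = scalar_conj R s (dot y x).
Proof. by rewrite hermC expr0 mul1r. Qed.

Lemma dot_ge0 x : 0 <= dot x x.
Proof.
have [->|x0] := eqVneq x 0; first by rewrite linear0r.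
exact/ltW/neq0_dnorm_gt0.
Qed.

Definition orthonormal_family (X : seq H) :=
  forall i j, (i < size X)%N -> (j < size X)%N -> dot X`_i X`_j = (i == j)%:R.

Lemma orthonormal_coord X (k : 'I_(size X) -> F) (i : 'I_(size X)) :
  orthonormal_family X -> dot (\sum_j k j *: X`_j) X`_i = k i.
Proof.
move=> Xo; rewrite linear_sumlz (bigD1 i) //= big1 => [|j ji].
  by rewrite linearZl_LR /= Xo // eqxx mulr1 addr0.
by rewrite linearZl_LR /= Xo // val_eqE (negPf ji) mulr0.
Qed.

Lemma orthonormal_family_free X : orthonormal_family X -> free X.
Proof.
move=> Xo; apply/(@freeP _ _ _ (in_tuple X)) => k k0 i.
by rewrite -(orthonormal_coord k i Xo) k0 linear0l.
Qed.

(** Here [y] is the Fourier sum of [x] along [X]. The residue [x - y] serves both Gram-Schmidt and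
    the splitting of the space by [V] and its orthogonal complement. *)
Lemma orthonormal_residue X x : orthonormal_family X ->
  exists2 y, y \in <<X>>%VS & forall i, (i < size X)%N -> dot (x - y) X`_i = 0.
Proof.
move=> Xo; exists (\sum_(j < size X) dot x X`_j *: X`_j).
  by apply: memv_suml => j _; rewrite memvZ // memv_span // mem_nth.
move=> i iX; rewrite linearBl; apply/eqP; rewrite subr_eq0 eq_sym; apply/eqP.
exact: (orthonormal_coord (fun j => dot x X`_j) (Ordinal iX) Xo).
Qed.

Lemma ex_orthonormal_basis (V : {vspace H}) :
  exists X : (\dim V).-tuple H, <<X>>%VS = V /\ orthonormal_family X.
Proof.
(* Gram-Schmidt: fewer than [\dim V] vectors cannot span [V], so some [x] in [V] has a nonzero
   residue, which is normalized and appended. *)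
have Xn n : (n <= \dim V)%N -> exists X : n.-tuple H, (<<X>> <= V)%VS /\ orthonormal_family X.
  elim: n => [|n IHn] nV; first by exists [tuple]; rewrite span_nil sub0v.
  have [X [XV Xo]] := IHn (ltnW nV).
  have /subvPn[x xV xX] : ~~ (V <= <<X>>)%VS.
    apply: contraL nV => /dimvS dVX; rewrite -leqNgt.
    by rewrite (leq_trans dVX) // (leq_trans (dim_span X)) // size_tuple.
  have [y yX xyX] := orthonormal_residue x Xo.
  have z0 : x - y != 0 by apply: contraNneq xX => /subr0_eq ->.
  have [|c c2] := @ex_norm_sqr R s (dot (x - y) (x - y))^-1.
    by rewrite invr_ge0 dot_ge0.
  exists [tuple of rcons X (c *: (x - y))]; split.
    rewrite /= -cats1 span_cat subv_add XV span_seq1 -memvE memvZ // memvB //.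
    exact: (subvP XV).
  have zz : dot (c *: (x - y)) (c *: (x - y)) = 1.
    rewrite linearZl_LR linearZr_LR /= mulrA c2 mulVf //.
    by rewrite gt_eqF ?neq0_dnorm_gt0.
  move=> i j; rewrite /= size_rcons !ltnS !nth_rcons.
  rewrite leq_eqVlt => /orP[/eqP-> | iX]; rewrite leq_eqVlt => /orP[/eqP->|jX].
  - by rewrite ltnn eqxx zz.
  - by rewrite ltnn eqxx jX linearZl_LR /= xyX // mulr0 gtn_eqF.
  - by rewrite ltnn eqxx iX linearZr_LR /= dotC xyX // rmorph0 mulr0 ltn_eqF.
  - by rewrite iX jX Xo.
have [X [XV Xo]] := Xn _ (leqnn (\dim V)).
exists X; split=> //; apply/eqP; rewrite eqEdim XV /=.
by move/orthonormal_family_free: Xo; rewrite /free => /eqP->; rewrite size_tuple.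
Qed.

(** Together with [capv_orthov] this makes the two subspaces complementary, so that the [daddv_pi]
    in [orthoproj] is the genuine orthogonal projection. *)
Lemma addv_orthov (V : {vspace H}) : (V + orthov dot V)%VS = fullv.
Proof.
apply/eqP; rewrite eqEsubv subvf; apply/subvP=> x _.
have [X [XV Xo]] := ex_orthonormal_basis V.
have [y yX xyX] := orthonormal_residue x Xo.
rewrite -(subrK y x) addrC memv_add //; first by rewrite -XV.
apply/mem_orthovP => v; rewrite -{1}XV => /(@coord_span _ _ _ X) ->.
rewrite linear_sumr big1 // => i _.
by rewrite linearZr_LR /= xyX ?size_tuple // mulr0.
Qed.

Lemma capv_orthov (V : {vspace H}) : (V :&: orthov dot V)%VS = 0%VS.
Proof.
apply/eqP; rewrite -subv0; apply/subvP=> x /memv_capP[xV /mem_orthovP/(_ x xV)].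
by rewrite memv0; apply: contra_eqT => /neq0_dnorm_gt0 /gt_eqF->.
Qed.

Lemma orthoproj_id (V : {vspace H}) x : x \in V -> orthoproj dot V x = x.
Proof. by move=> xV; rewrite daddv_pi_id ?capv_orthov. Qed.

(** Pythagoras for the decomposition of [x] along [V] and its orthogonal complement. *)
Lemma dot_orthoproj_le (V : {vspace H}) x :
  dot (orthoproj dot V x) (orthoproj dot V x) <= dot x x.
Proof.
set y := orthoproj dot V x; set z := daddv_pi (orthov dot V) V x.
have xyz : y + z = x.
  by rewrite daddv_pi_add ?capv_orthov // addv_orthov memvf.
have zy0 : dot z y = 0.
  by have /mem_orthovP := memv_pi (orthov dot V) V x; apply; apply: memv_pi.
have yz0 : dot y z = 0 by rewrite dotC zy0 rmorph0.
by rewrite -xyz hnormDd //= lerDl dot_ge0.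
Qed.

End Hilbert.

(** * Coordinates in which commuting isometries are diagonal *)

Section Coordinates.
Local Open Scope sesquilinear_scope.
Variables (R : realType) (s : scalar_kind).
Local Notation F := (scalars R s).
Local Notation tc := (to_complex R s).
Local Notation normc := ComplexField.Normc.normc.
Variables (K : vectType F) (dot : hilbert_dot R s K).

Section OrthonormalBasis.
Variables (n : nat) (e : n.-tuple K).
Hypothesis e_span : <<e>>%VS = fullv.
Hypothesis e_orthonormal : orthonormal_family dot e.

Definition coord_row (x : K) : 'rV[R[i]]_n := \row_j tc (dot x e`_j).

Lemma coord_rowP a x y : coord_row (a *: x + y) = tc a *: coord_row x + coord_row y.
Proof.
by apply/rowP=> j; rewrite !mxE linearDl linearZl_LR /= rmorphD rmorphM.
Qed.

Lemma coord_row_sum m (a : 'I_m -> F) (x : 'I_m -> K) :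
  coord_row (\sum_i a i *: x i) = \sum_i tc (a i) *: coord_row (x i).
Proof.
apply/rowP=> j; rewrite summxE mxE linear_sumlz rmorph_sum.
by apply: eq_bigr => i _; rewrite !mxE linearZl_LR rmorphM.
Qed.

Lemma dot_basis (i j : 'I_n) : dot e`_i e`_j = (i == j)%:R.
Proof. by rewrite e_orthonormal ?size_tuple. Qed.

Lemma orthonormal_expansion x : x = \sum_(i < n) dot x e`_i *: e`_i.
Proof.
have xe : x \in <<e>>%VS by rewrite e_span memvf.
rewrite [LHS](coord_span xe); apply: eq_bigr => i _; congr (_ *: _).
rewrite [in RHS](coord_span xe) linear_sumlz (bigD1 i) //= big1 => [|j ji].
  by rewrite linearZl_LR /= dot_basis eqxx mulr1 addr0.
by rewrite linearZl_LR /= dot_basis (negPf ji) mulr0.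
Qed.

(** Parseval's identity, read over the complex numbers. *)
Lemma coord_row_dot x y : tc (dot x y) = (coord_row x *m (coord_row y)^t*) 0 0.
Proof.
rewrite {1}(orthonormal_expansion x) linear_sumlz rmorph_sum mxE.
apply: eq_bigr => j _; rewrite !mxE linearZl_LR /= rmorphM -to_complex_conj.
by rewrite -dotC.
Qed.

(** Vectors are rows, so the matrix acts on the right and composition reverses the order of
    products. *)
Definition coord_mx (U : 'End(K)) : 'M[R[i]]_n := \matrix_i coord_row (U e`_i).

Lemma coord_mxE (U : 'End(K)) x : coord_row (U x) = coord_row x *m coord_mx U.
Proof.
rewrite {1}(orthonormal_expansion x) linear_sum /=.
under eq_bigr do rewrite linearZ /=.
rewrite coord_row_sum mulmx_sum_row; apply: eq_bigr => i _.
by rewrite rowK mxE.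
Qed.

Lemma coord_mx_comp (U V : 'End(K)) : coord_mx (U \o V)%VF = coord_mx V *m coord_mx U.
Proof.
by apply/row_matrixP=> i; rewrite row_mul !rowK comp_lfunE coord_mxE.
Qed.

Lemma coord_mx_unitary (U : 'End(K)) : isometry dot dot U -> coord_mx U \is unitarymx.
Proof.
move=> Uiso; apply/unitarymxP/matrixP=> i j.
rewrite mxE; transitivity (tc (dot (U e`_i) (U e`_j))).
  by rewrite coord_row_dot mxE; apply: eq_bigr => l _; rewrite !mxE.
by rewrite Uiso /= dot_basis rmorph_nat mxE.
Qed.

End OrthonormalBasis.

(** [phi] is a bare function, with its linearity stated through [tc], because [K] may be a real
    space while the rows are complex. *)
Lemma commuting_isometries_codiagonalization k (U : 'I_k -> 'End(K))
    (m := \dim {:K}) :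
    (forall i, isometry dot dot (U i)) -> commuting U ->
  exists (phi : K -> 'rV[R[i]]_m) (w : 'I_m -> 'I_k -> R[i]),
    [/\ forall j, torus R k (w j),
        forall a x y, phi (a *: x + y) = tc a *: phi x + phi y,
        forall x, hnorm dot x = Num.sqrt (\sum_j normc (phi x 0 j) ^+ 2) &
        forall i x j, phi (U i x) 0 j = w j i * phi x 0 j].
Proof.
move=> Uiso Ucomm; have [e [e_span e_o]] := ex_orthonormal_basis dot {:K}.
pose B i := coord_mx e (U i).
have [i|i j|P Pu [d d1 BP]] := @unitarymx_codiagonalization _ _ _ B.
- exact: coord_mx_unitary.
- by rewrite /comm_mx -!coord_mx_comp // Ucomm.
exists (fun x => coord_row e x *m P^t*), (fun j i => d i 0 j); split.
- by move=> j i; have := d1 i j; rewrite norm_complexE => -[].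
- by move=> a x y; rewrite coord_rowP mulmxDl -scalemxAl.
- move=> x; rewrite /hnorm; congr Num.sqrt.
  (* The change of basis by [P^t*] is unitary, so Parseval survives it. *)
  have PtP : P^t* *m P = 1%:M.
    by rewrite -invmx_unitary // mulVmx // unitarymx_unit.
  set v := coord_row e x *m P^t*.
  have -> : tc (dot x x) = (v *m v^t*) 0 0.
    rewrite trmx_mul map_mxM trmxCK !mulmxA -[X in X *m _]mulmxA PtP mulmx1.
    exact: coord_row_dot.
  rewrite mxE raddf_sum; apply: eq_bigr => j _.
  by rewrite [v^t* _ _]mxE [v^T _ _]mxE -normCK norm_complexE -rmorphXn.
- move=> i x j; rewrite coord_mxE // -mulmxA BP mulmxA mul_mx_diag mxE.
  by rewrite mulrC.
Qed.

End Coordinates.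

(** * The norm bound for polynomials in commuting isometries *)

Section VonNeumann.
Variables (R : realType) (s : scalar_kind).
Local Notation F := (scalars R s).
Local Notation tc := (to_complex R s).
Local Notation normc := ComplexField.Normc.normc.
Variables (K : vectType F) (dot : hilbert_dot R s K).

Lemma ler_hnorm (H : vectType F) (dotH : hilbert_dot R s H) (x : H) (y : K) :
  dotH x x <= dot y y -> hnorm dotH x <= hnorm dot y.
Proof.
(* The order on [R[i]] compares real parts of numbers with equal imaginary parts, hence gives the
   inequality of real parts under the roots. *)
rewrite -subr_ge0 => /to_complex_ge0; rewrite rmorphB subr_ge0 /hnorm.
move: (tc _) (tc _) => [a b] [c d] /=; rewrite lecE /= => /andP[_].
exact: ler_wsqrtr.
Qed.

Lemma hnorm_poly_op_le k (U : 'I_k -> 'End(K)) (m := \dim {:K}) :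
    (forall i, isometry dot dot (U i)) -> commuting U ->
  exists2 w : 'I_m -> 'I_k -> R[i], (forall j, torus R k (w j)) &
    forall p x, hnorm dot (poly_op U p x)
       <= \big[Num.max/0]_(j < m) normc (poly_at p (w j)) * hnorm dot x.
Proof.
move=> Uiso Ucomm.
have [phi [w [wT phiP phi_norm phiU]]] := commuting_isometries_codiagonalization Uiso Ucomm.
have phi0 : phi 0 = 0.
  by have := phiP (-1) 0 0; rewrite rmorphN1 !scaleN1r !(oppr0, addr0, addNr).
have phi_sum I r (a : I -> F) (x : I -> K) :
    phi (\sum_(i <- r) a i *: x i) = \sum_(i <- r) tc (a i) *: phi (x i).
  by elim/big_rec2: _ => // i y z _ <-; rewrite phiP.
have phi_monomial n x j : phi (monomial_op U n x) 0 j = (\prod_i w j i ^+ n i) * phi x 0 j.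
  (* Acting on the [j]-th coordinate as a scalar is stable under composition, so it passes to the
     iterated compositions in [monomial_op]. *)
  pose diag (f : 'End(K)) c := forall x, phi (f x) 0 j = c * phi x 0 j.
  have diag_id : diag \1%VF 1 by move=> y; rewrite id_lfunE mul1r.
  have diag_comp f g c d : diag f c -> diag g d -> diag (f \o g)%VF (c * d).
    by move=> fc gd y; rewrite comp_lfunE fc gd mulrA.
  suff: diag (monomial_op U n) (\prod_i w j i ^+ n i) by apply.
  apply: (big_ind2 diag) => // [f c g d|i _]; first exact: diag_comp.
  elim: (n i) => [|l IHl] //=; rewrite exprS; apply: diag_comp => //.
have phi_poly p x j : phi (poly_op U p x) 0 j = poly_at p (w j) * phi x 0 j.
  rewrite sum_lfunE; under eq_bigr do rewrite scale_lfunE.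
  rewrite phi_sum summxE /poly_at /mmap mulr_suml; apply: eq_bigr => n _.
  by rewrite mxE phi_monomial mulrA.
exists w; first exact: wT.
move=> p x; set M := \big[_/_]_(j < m) _.
have M0 : 0 <= M by apply: bigmax_ge_id.
(* With [M] moved under the root as [M ^+ 2], the two sums of squares are compared term by term. *)
rewrite !phi_norm -[M]ger0_norm // -sqrtr_sqr -sqrtrM ?sqr_ge0 //.
rewrite ler_wsqrtr // mulr_sumr; apply: ler_sum => j _.
rewrite phi_poly ComplexField.Normc.normcM exprMn ler_wpM2r ?sqr_ge0 //.
by rewrite lerXn2r ?nnegrE ?normc_ge0 //; apply: le_bigmax.
Qed.

End VonNeumann.

(** * Compression to [H] and the supremum over the torus *)

Section Dilation.
Variables (R : realType) (s : scalar_kind).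
Local Notation F := (scalars R s).
Local Notation tc := (to_complex R s).
Local Notation normc := ComplexField.Normc.normc.

Lemma opnorm_le (H : vectType F) (dot : hilbert_dot R s H) (T : 'End(H)) (M : R) :
  0 <= M -> (forall x, hnorm dot (T x) <= M * hnorm dot x) -> opnorm dot T <= M.
Proof.
move=> M0 TM; apply: ge_sup => [|_ [x x1 <-]].
  (* Bounding the [sup] requires a nonempty set: the zero vector lies in the unit ball. *)
  by exists (hnorm dot (T 0)), 0 => //=; rewrite /hnorm linear0r rmorph0 sqrtr0.
by rewrite (le_trans (TM x)) // ler_piMr.
Qed.

Lemma poly_op_dilation (H K : vectType F) (dotH : hilbert_dot R s H)
    (dotK : hilbert_dot R s K) (emb : 'Hom(H, K)) N k (T : 'I_k -> 'End(H)) U p h :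
    unitary_dilation dotH dotK emb N T U -> (msize p <= N.+1)%N ->
  emb (poly_op T p h) = orthoproj dotK (limg emb) (poly_op U p (emb h)).
Proof.
case=> _ _ _ dil pN; rewrite !sum_lfunE !linear_sum.
apply: eq_big_seq => n np; rewrite !scale_lfunE !linearZ; congr (_ *: _).
(* Each monomial of the support has degree below [msize p], hence at most [N], so the dilation
   identity applies to it. *)
rewrite [LHS]dil; last by rewrite -mdegE -ltnS (leq_trans (msize_mdeg_lt np)).
by rewrite (orthoproj_id _ (memv_img _ (memvf h))).
Qed.

Lemma hnorm_dilation_le (H K : vectType F) (dotH : hilbert_dot R s H)
    (dotK : hilbert_dot R s K) (emb : 'Hom(H, K)) N k (T : 'I_k -> 'End(H)) U p h :
    unitary_dilation dotH dotK emb N T U -> (msize p <= N.+1)%N ->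
  hnorm dotH (poly_op T p h) <= hnorm dotK (poly_op U p (emb h)).
Proof.
move=> dil pN; apply: ler_hnorm; have [emb_iso _ _ _] := dil.
by rewrite -emb_iso (poly_op_dilation _ dil pN) dot_orthoproj_le.
Qed.

(** Monomials have modulus at most 1 on the torus. The bound does not depend on [z], so the set
    defining [torus_sup_norm] is bounded and its [sup] is a true supremum. *)
Lemma normc_poly_at_bound k (p : {mpoly F[k]}) (z : 'I_k -> R[i]) :
  torus R k z -> normc (poly_at p z) <= \sum_(n <- msupp p) normc (tc p@_n).
Proof.
move=> z1; rewrite /poly_at /mmap -lecR (rmorph_sum (real_complex R)).
rewrite -norm_complexE; apply: le_trans (ler_norm_sum _ _ _) _.
apply: ler_sum => n _; rewrite normrM norm_complexE ler_piMr //.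
  by rewrite ler0c normc_ge0.
rewrite normr_prod prodr_ile1 // => i _; rewrite normr_ge0 normrX.
by rewrite norm_complexE z1 expr1n lexx.
Qed.

Lemma le_torus_sup_norm k (p : {mpoly F[k]}) (z : 'I_k -> R[i]) :
  torus R k z -> normc (poly_at p z) <= torus_sup_norm p.
Proof.
move=> z1; apply: ub_le_sup; last by exists z.
by exists (\sum_(n <- msupp p) normc (tc p@_n)) => _ [y y1 <-]; apply: normc_poly_at_bound.
Qed.

(** Needed for the initial value [0] of the maximum over the points [w i]; the constant point 1
    shows that the torus is nonempty. *)
Lemma torus_sup_norm_ge0 k (p : {mpoly F[k]}) : 0 <= torus_sup_norm p.
Proof.
apply: le_trans (le_torus_sup_norm p (z := fun=> 1) _); first exact: normc_ge0.
by move=> i; rewrite ComplexField.Normc.normc1.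
Qed.

End Dilation.

Unset Implicit Arguments.
Set Strict Implicit.
Set Printing Implicit Defensive.

(* [msize p] is the total degree plus one ([0] for the zero polynomial). The
   maximum over an empty family (which occurs only for dim K = 0) is 0. *)
Theorem theorem4p4 (R : realType) (s : scalar_kind)
    (H : vectType (scalars R s)) (dotH : hilbert_dot R s H)
    (N : nat) (hN : (0 < N)%N) (k : nat) (T : 'I_k -> 'End(H))
    (hTcomm : commuting T) (hTcontr : forall i, contraction dotH (T i))
    (K : vectType (scalars R s)) (dotK : hilbert_dot R s K)
    (hdil : exists (emb : 'Hom(H, K)) (U : 'I_k -> 'End(K)),
       unitary_dilation dotH dotK emb N T U) :
  let m := \dim {:K} in
  (exists w : 'I_m -> 'I_k -> R[i]%C,
     (forall i, torus R k (w i)) /\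
     (forall p : {mpoly (scalars R s)[k]}, (msize p <= N.+1)%N ->
        opnorm dotH (poly_op T p)
          <= \big[Num.max/0]_(i < m) ComplexField.Normc.normc (poly_at p (w i))))
  /\
  (forall p : {mpoly (scalars R s)[k]}, (msize p <= N.+1)%N ->
     opnorm dotH (poly_op T p) <= torus_sup_norm p).
Proof.
move=> m; have [emb [U dil]] := hdil.
have [emb_iso Uunitary Ucomm _] := dil.
have [w w1 Uw] := hnorm_poly_op_le (fun i => (Uunitary i).1) Ucomm.
have Tw p : (msize p <= N.+1)%N ->
    opnorm dotH (poly_op T p) <= \big[Num.max/0]_(i < m) ComplexField.Normc.normc (poly_at p (w i)).
  move=> pN; apply: opnorm_le => [|h]; first exact: bigmax_ge_id.
  apply: le_trans (hnorm_dilation_le _ dil pN) _.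
  by rewrite (le_trans (Uw _ _)) // /hnorm emb_iso.
split; first by exists w.
move=> p /Tw/le_trans; apply; apply: bigmax_le => [|i _].
  exact: torus_sup_norm_ge0.
exact: le_torus_sup_norm.
Qed.
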